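(* There is an absolute constant $c>0$ such that for any probability distribution $p=(p_i)_{i\in\mathbb{N}}$ on $\mathbb{N}$ and its corresponding MLE $\hat p$ based on $n$ independent observations, $$\liminf_{n\to\infty}\sqrt n\,\mathbb{E}\|p-\hat p\|_\infty\ge c\sqrt{V^*(p)}.$$
   Context: $\mathbb{N}=\{1,2,\dots\}$. For i.i.d. draws $X^n=(X_1,\dots,X_n)$ from $p$, $\hat p_i=c_i(X^n)/n$ where $c_i(X^n)$ is the number of appearances of symbol $i$. $\|p-\hat p\|_\infty=\sup_{i\in\mathbb{N}}|p_i-\hat p_i|$. $V^*(p)=\sup_{i\in\mathbb{N}}p^\downarrow_i(1-p^\downarrow_i)\log(i+1)$, where $p^\downarrow$ is $p$ sorted in non-increasing order. *)

(* Defs.v *)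
From HB Require Import structures.
From mathcomp Require Import all_boot all_order all_algebra.
From mathcomp Require Import all_classical all_reals all_analysis.
Import Order.TTheory GRing.Theory Num.Theory.
Import numFieldNormedType.Exports.

Set Implicit Arguments.
Unset Strict Implicit.
Unset Printing Implicit Defensive.

Local Open Scope classical_set_scope.
Local Open Scope ring_scope.

(** The alphabet {1, 2, ...} is represented by [nat] through the shift
    [i |-> i + 1]; the labels themselves play no role.  Ranks in the sorted
    sequence are shifted as well: [decr p i] is the (i+1)-st largest mass. *)

Definition is_distribution (R : realType) (p : nat -> R) : Prop :=
  (forall i, 0 <= p i) /\ (\sum_(0 <= i <oo) (p i)%:E = 1)%E.

(** [s] enumerates symbols without repetition, in order of non-increasing mass,
    and misses no symbol of positive mass.  One cannot ask for [s] to be a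
    bijection: if infinitely many symbols have positive mass, those of mass
    zero never get a turn. *)
Definition sorts (R : realType) (p : nat -> R) (s : nat -> nat) : Prop :=
  [/\ injective s,
      (forall j, p j != 0 -> exists i, s i = j) &
      (forall i j, (i <= j)%N -> p (s j) <= p (s i))].

(** Existence of a sorting enumeration and independence of [decr p] from the
    one chosen are [sorts_exists] and [sorts_unique] below. *)
Definition decr (R : realType) (p : nat -> R) : nat -> R :=
  p \o xget (id : nat -> nat) [set s | sorts p s].

(** A supremum of reals, legitimate by [Vstar_has_sup] below. With ranks
    starting at 0, log(i + 1) becomes [ln i.+2%:R]. *)
Definition Vstar (R : realType) (p : nat -> R) : R :=
  sup (range (fun i => decr p i * (1 - decr p i) * ln i.+2%:R)).

Definition mle (R : realType) (n : nat) (x : 'I_n -> nat) (i : nat) : R :=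
  #|[pred k | x k == i]|%:R / n%:R.

(** Bounded, hence a genuine supremum, when [p] and [q] take values in [0, 1]. *)
Definition sup_dist (R : realType) (p q : nat -> R) : R :=
  sup (range (fun i => `|p i - q i|)).

(** Taking some of the [A k] to be the whole space gives the product rule for
    every subfamily. *)
Definition mutually_independent d d' (Omega : measurableType d)
    (T : measurableType d') (R : realType) (P : probability Omega R) (n : nat)
    (X : 'I_n -> {RV P >-> T}) : Prop :=
  forall A : 'I_n -> set T, (forall k, measurable (A k)) ->
    P (\bigcap_k (X k @^-1` A k)) = (\prod_(k < n) P (X k @^-1` A k))%E.

Definition iid_draws d (Omega : measurableType d) (R : realType)
    (P : probability Omega R) (p : nat -> R) (n : nat)
    (X : 'I_n -> {RV P >-> nat}) : Prop :=
  mutually_independent X /\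
  (forall k i, P (X k @^-1` [set i]) = (p i)%:E).

Section sorting.
Context {R : realType} (p : nat -> R) (hp : is_distribution p).

Let p_ge0 i : 0 <= p i. Proof. exact: hp.1. Qed.

Lemma uniq_sum_le1 (l : seq nat) : uniq l -> \sum_(i <- l) p i <= 1.
Proof.
move=> ul; pose N := (\max_(i <- l) i).+1.
have lN : {subset l <= iota 0 N}.
  by move=> x xl; rewrite mem_iota /= add0n ltnS; apply: leq_bigmax_seq.
have h1 : \sum_(i <- l) p i <= \sum_(0 <= i < N) p i.
  rewrite [leRHS](bigID (mem l)) /= /index_iota subn0.
  have -> : \sum_(i <- l) p i = \sum_(i <- iota 0 N | i \in l) p i.
    rewrite -[RHS]big_filter; apply: perm_big; apply: uniq_perm => //.
      exact/filter_uniq/iota_uniq.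
    move=> x; rewrite mem_filter; case: (boolP (x \in l)) => //= /lN ->//.
  by rewrite lerDl sumr_ge0.
apply: (le_trans h1); rewrite -lee_fin -sumEFin -hp.2.
by apply: (@nneseries_lim_ge _ _ xpredT) => i _ _; rewrite lee_fin.
Qed.

Lemma mass_decay (e : R) : 0 < e -> exists N, forall i, (N <= i)%N -> p i < e.
Proof.
move=> e0.
have cvg_sp : cvgn (series p).
  apply: nondecreasing_is_cvgn.
    exact: nondecreasing_series.
  exists 1 => _ [n _ <-]; rewrite /series /=.
  by apply: uniq_sum_le1; exact: iota_uniq.
have /cvgrPdist_lt /(_ _ e0) [N _ hN] := cvg_series_cvg_0 cvg_sp.
exists N => i Ni; have := hN i Ni.
by rewrite /= sub0r normrN ger0_norm.
Qed.

Lemma heaviest_remaining (l : seq nat) :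
  exists j, j \notin l /\ forall i, i \notin l -> p i <= p j.
Proof.
have [[j0 j0l pj0]|h] := pselect (exists2 j, j \notin l & 0 < p j).
  have [N hN] := mass_decay pj0.
  have j0N : (j0 < N)%N.
    by rewrite ltnNge; apply/negP => /hN; rewrite ltxx.
  case: (@Order.TotalTheory.arg_maxP _ _ 'I_N (Ordinal j0N)
    (fun i => val i \notin l) (fun i => p (val i)) j0l) => j jl jmax.
  exists (val j); split => // i il; have [iN|Ni] := ltnP i N.
    exact: (jmax (Ordinal iN)).
  apply: le_trans (jmax (Ordinal j0N) j0l).
  exact/ltW/hN.
exists (\max_(i <- l) i).+1; split.
  by apply/negP => /(@leq_bigmax_seq _ _ xpredT id) /(_ isT); rewrite ltnn.
move=> i il; apply: le_trans (p_ge0 _).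
by rewrite leNgt; apply/negP => pi0; apply: h; exists i.
Qed.

Lemma sorts_exists : exists s, sorts p s.
Proof.
have [next nextP] := choice heaviest_remaining.
pose L := fix L n := if n is m.+1 then rcons (L m) (next (L m)) else [::].
pose s n := next (L n).
have LE n : L n = [seq s i | i <- iota 0 n].
  elim: n => [//|n IH].
  by rewrite -addn1 iotaD map_cat -IH /= addn1 /= cats1.
have fresh n i : (i < n)%N -> s n != s i.
  move=> ltin; have [h _] := nextP (L n).
  apply: contraNneq h; rewrite -/(s n) => ->.
  by rewrite LE map_f// mem_iota.
have mono i j : (i <= j)%N -> p (s j) <= p (s i).
  move=> ij; have [_ h] := nextP (L i); apply: h.
  rewrite LE; apply/mapP => -[k]; rewrite mem_iota add0n => /andP[_ ki] sjk.
  by have := fresh j k (leq_trans ki ij); rewrite sjk eqxx.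
have inj : injective s.
  move=> i j sij; case: (ltngtP i j) => // /fresh; rewrite ?sij ?eqxx//.
exists s; split => // j pj0.
apply/not_existsP => hj.
have pj : 0 < p j by rewrite lt_neqAle eq_sym pj0 p_ge0.
have [N hN] := mass_decay pj.
have sN n : (s n < N)%N.
  rewrite ltnNge; apply/negP => /hN; rewrite ltNge => /negP; apply.
  have [_ h] := nextP (L n); apply: h.
  by rewrite LE; apply/mapP => -[k _ sjk]; apply: (hj k).
have := @uniq_leq_size _ [seq s i | i <- iota 0 N.+1] (iota 0 N).
rewrite map_inj_uniq// iota_uniq => /(_ isT).
rewrite size_map !size_iota ltnn => H.
suff : false by []. apply: H => x /mapP[k _ ->]; rewrite mem_iota /= add0n; exact: sN.
Qed.

Lemma sorts_le s t : sorts p s -> sorts p t -> forall k, p (s k) <= p (t k).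
Proof.
move=> [sinj _ smono] [tinj tcov tmono] k; rewrite leNgt; apply/negP => lt_ts.
have := @uniq_leq_size _ [seq s i | i <- iota 0 k.+1] [seq t i | i <- iota 0 k].
rewrite map_inj_uniq// iota_uniq => /(_ isT).
rewrite !size_map !size_iota ltnn => H.
suff : false by []. apply: H => x /mapP[i]; rewrite mem_iota add0n ltnS => ik ->.
have lti : p (t k) < p (s i) by exact: lt_le_trans lt_ts (smono _ _ ik).
have [m tm] : exists m, t m = s i.
  by apply: tcov; rewrite gt_eqF//; exact: le_lt_trans lti.
rewrite -tm map_f// mem_iota add0n /= ltnNge; apply/negP => km.
by have := tmono _ _ km; rewrite tm leNgt lti.
Qed.

Lemma sorts_unique s t : sorts p s -> sorts p t -> p \o s = p \o t.
Proof.
move=> hs ht; apply/funext => k /=.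
by apply/eqP; rewrite eq_le !sorts_le.
Qed.

Lemma decrE s : sorts p s -> decr p = p \o s.
Proof.
move=> hs; apply: sorts_unique => //.
by have [t ht] := sorts_exists; apply: (@xgetI _ _ _ t).
Qed.

Lemma decr_le_inv i : decr p i <= i.+1%:R^-1.
Proof.
have [s hs] := sorts_exists; rewrite (decrE hs) /=.
case: hs => sinj _ smono.
rewrite -[leRHS]mul1r ler_pdivlMr ?ltr0n//.
apply: le_trans (uniq_sum_le1 (l := [seq s k | k <- iota 0 i.+1]) _); last first.
  by rewrite map_inj_uniq// iota_uniq.
rewrite big_map.
have -> : p (s i) * i.+1%:R = \sum_(k <- iota 0 i.+1) p (s i).
  by rewrite big_const_seq count_predT size_iota iter_addr_0 mulr_natr.
rewrite big_seq [leRHS]big_seq; apply: ler_sum => k.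
by rewrite mem_iota add0n ltnS => /smono.
Qed.

Lemma Vstar_has_sup :
  has_sup (range (fun i => decr p i * (1 - decr p i) * ln i.+2%:R)).
Proof.
split; first by exists (decr p 0 * (1 - decr p 0) * ln 2%:R), 0%N.
exists 1 => _ [i _ <-].
have q0 : 0 <= decr p i by exact: p_ge0.
have l0 : 0 <= ln i.+2%:R :> R by rewrite ln_ge0// ler1n.
have li : ln i.+2%:R <= i.+1%:R :> R.
  rewrite -[i.+2]addn1 natrD addrC; apply: le_ln1Dx.
  by apply: lt_le_trans (ler0n _ _); rewrite ltrN10.
rewrite (@le_trans _ _ (decr p i * ln i.+2%:R))//.
  by rewrite ler_wpM2r// -[leRHS]mulr1 ler_wpM2l// gerBl.
rewrite (@le_trans _ _ (i.+1%:R^-1 * i.+1%:R))//.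
  by apply: ler_pM => //; exact: decr_le_inv.
by rewrite mulVf// pnatr_eq0.
Qed.

End sorting.

(* Main.v *)
Require Import Defs.
From mathcomp Require Import all_boot all_order all_algebra.
From mathcomp Require Import all_classical all_reals all_analysis.
From mathcomp Require Import measurable_realfun.
From mathcomp Require Import ring lra.
Import Order.TTheory GRing.Theory Num.Theory.
Local Open Scope classical_set_scope.
Local Open Scope ring_scope.

Set Implicit Arguments.
Unset Strict Implicit.
Unset Printing Implicit Defensive.

(** Fix a rank and let [q] be the mass of the symbol of that rank, [v = q (1 - q)],
    and [m] the number of symbols up to that rank.  The centred counts of these
    [m] symbols, divided by [sqrt n], behave like negatively correlated Gaussians
    of variance at least [v], so the largest of them should be of order
    [sqrt (v ln (m + 1))].  This is made precise by a second moment argument on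
    exponential moments.

    For a symbol [i] with count [c_i], the exponentially tilted weight
    [W_i = exp (s_i c_i) / E exp (s_i c_i)] ([tilt]) has mean 1, and independence
    of the draws gives its mixed moments exactly, as [n]-th powers
    ([has_mean_prod_two]).  With [s_i = lam / sqrt (n p_i (1 - p_i))] one finds
    [E W_i^2 <= exp (4 lam^2)] ([tilt_mean_sq]), whereas [E (W_i W_j) <= 1] for
    distinct symbols because counts compete for the same draws
    ([tilt_mean_cross]).  Hence the average [S] of the [m] weights satisfies
    [E S = 1] and [E S^2 <= 1 + exp (4 lam^2) / m], which stays bounded when
    [lam^2 = 16 + ln (m + 1) / 4].  By the Paley-Zygmund inequality
    ([paley_zygmund_half]), [S >= 1/2] with probability bounded below by an
    absolute constant.  On that event some [W_i >= 1/2], which, by a lower bound on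
    the moment generating function of a Bernoulli variable ([bernoulli_mgf_ge]),
    forces [c_i - n p_i >= lam sqrt (n p_i (1 - p_i)) / 16] ([tilt_large]).  So the
    expected sup distance is at least a constant times [lam sqrt (v / n)]
    ([expected_sup_dist_ge]) as soon as [n >= 4 lam^2 / v].  The additive 16 in
    [lam^2] lets the same argument cover small [m], including [m = 1].

    Letting [n] tend to infinity for each rank, and then taking the supremum over
    ranks, gives the theorem.  The variances of the heavier symbols are at least
    [v], even though [x (1 - x)] is not monotone, because two distinct masses add
    up to at most 1 ([heavier_variance]). *)

(** * Means, Paley-Zygmund and Markov *)

Section has_mean.
Context d (T : measurableType d) (R : realType) (P : probability T R).
Implicit Types (f g : T -> R) (a b : R).

(** Integrability and value of the integral in one predicate, so that the
    closure lemmas below carry no side conditions. *)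
Definition has_mean f a :=
  P.-integrable setT (EFin \o f) /\ (\int[P]_w (f w)%:E = a%:E)%E.

Lemma has_mean_eq f g a b : f =1 g -> a = b -> has_mean f a -> has_mean g b.
Proof. by move=> /funext -> ->. Qed.

Lemma has_mean_indic (A : set T) a :
  measurable A -> P A = a%:E -> has_mean \1_A a.
Proof.
move=> mA PA; split; first exact: integrable_indic.
by rewrite integral_indic// setIT.
Qed.

Lemma has_mean_cst a : has_mean (cst a) a.
Proof.
split; first exact: finite_measure_integrable_cst.
by have /= -> := integral_cst P measurableT a%:E; rewrite probability_setT mule1.
Qed.

Lemma has_meanZ c f a : has_mean f a -> has_mean (fun w => c * f w) (c * a).
Proof.
move=> [intf meanf]; split.
  apply: eq_integrable (integrableZl (measurableT : measurable setT) c intf) => //.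
under eq_integral do rewrite EFinM.
by rewrite integralZl// meanf EFinM.
Qed.

Lemma has_meanD f g a b :
  has_mean f a -> has_mean g b -> has_mean (fun w => f w + g w) (a + b).
Proof.
move=> [intf meanf] [intg meang]; split.
  by apply: eq_integrable (integrableD _ intf intg).
by rewrite integralD_EFin// meanf meang EFinD.
Qed.

Lemma has_mean_sum (I : Type) (s : seq I) (F : I -> T -> R) (m : I -> R) :
  (forall i, has_mean (F i) (m i)) ->
  has_mean (fun w => \sum_(i <- s) F i w) (\sum_(i <- s) m i).
Proof.
move=> hF; elim: s => [|i s IH].
  by apply: has_mean_eq (has_mean_cst 0) => [w|]; rewrite big_nil.
by apply: has_mean_eq (has_meanD (hF i) IH) => [w|]; rewrite big_cons.
Qed.

Lemma has_mean_le f g a b :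
  has_mean f a -> has_mean g b -> (forall w, f w <= g w) -> a <= b.
Proof.
move=> [intf meanf] [intg meang] fg.
rewrite -lee_fin -meanf -meang; apply: le_integral => // w _.
by rewrite lee_fin.
Qed.

(** With [k = 1 / (2 B)], the quadratic [1 - (1 - k (S - 1/2))^2] lies below the
    indicator of [S >= 1/2]: it is at most 1, and nonpositive when [S < 1/2].  Its
    mean is at least [k - k^2 B = 1 / (4 B)]. *)
Lemma paley_zygmund_half S b B :
  has_mean S 1 -> has_mean (fun w => S w ^+ 2) b -> b <= B -> 0 < B ->
  measurable [set w | 2^-1 <= S w] /\
  ((4 * B)^-1%:E <= P [set w | (2^-1 <= S w)%R])%E.
Proof.
move=> S1 S2 bB B0.
have mS : measurable_fun setT S.
  by have [/measurable_int/measurable_EFinP] := S1.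
have mA : measurable [set w | 2^-1 <= S w].
  rewrite (_ : [set w | _] = S @^-1` `[2^-1, +oo[).
    by rewrite -[_ @^-1` _]setTI; exact: mS.
  by apply/seteqP; split => w /=; rewrite in_itv/= andbT.
split=> //.
set A := [set w | _] in mA *.
have PA : P A = (fine (P A))%:E by rewrite fineK// fin_num_measure.
rewrite PA lee_fin.
pose k := (2 * B)^-1.
have hq := has_meanD (has_meanD (has_meanZ (- k ^+ 2) S2)
  (has_meanZ (2 * k + k ^+ 2) S1)) (has_mean_cst (- k - k ^+ 2 / 4)).
have := has_mean_le hq (has_mean_indic mA PA) _.
have k0 : 0 < k by rewrite invr_gt0; lra.
have kB : k * B = 2^-1 by rewrite /k; field; lra.
have kE : (4 * B)^-1 = k / 2 by rewrite /k; field; lra.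
rewrite kE => H.
apply: le_trans (H _); last first.
  move=> w /=; rewrite indicE; have [wA|wA] := boolP (w \in A).
    by rewrite /=; have := sqr_ge0 (1 - k * (S w - 2^-1)); nra.
  have Sw : S w < 2^-1 by move: wA; rewrite notin_setE /= => /negP; rewrite -ltNge.
  by rewrite /=; have := sqr_ge0 (k * (S w - 2^-1)); nra.
have : k ^+ 2 * b <= k / 2.
  apply: (@le_trans _ _ (k ^+ 2 * B)); first by rewrite ler_wpM2l// sqr_ge0.
  by rewrite expr2 -mulrA kB.
have := sqr_ge0 k; nra.
Qed.

Import HBNNSimple.

(** Markov's inequality for a function [f] that need not be measurable: the
    integral of a nonnegative function is a supremum over simple functions below
    it, and [t] times the indicator of [A] is one of them.  It dispenses with the
    measurability of the sup distance. *)
Lemma markov_nonmeasurable (f : T -> R) (A : set T) t : measurable A -> 0 <= t ->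
  (forall w, 0 <= f w) -> (forall w, A w -> t <= f w) ->
  (t%:E * P A <= \int[P]_w (f w)%:E)%E.
Proof.
move=> mA t0 f0 tf.
rewrite ge0_integralTE; last by move=> w; rewrite lee_fin.
have -> : (t%:E * P A)%E = sintegral P (scale_nnsfun (indic_nnsfun R mA) t0).
  by rewrite sintegralrM sintegral_indic.
apply: ereal_sup_ubound; exists (scale_nnsfun (indic_nnsfun R mA) t0) => // w.
rewrite lee_fin (_ : _ w = t * \1_A w)// indicE; have [wA|_] := boolP (w \in A).
  by rewrite mulr1; apply: tf; rewrite -in_setE.
by rewrite mulr0.
Qed.

End has_mean.

(** * Moments of products over independent draws *)

Section draws.
Context d (T : measurableType d) (R : realType) (P : probability T R).
Variables (p : nat -> R) (n : nat) (X : 'I_n -> {RV P >-> nat}).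
Hypothesis iidX : iid_draws p X.

(** Expanding the product turns it into a finite combination of indicators of
    events [X_k \in A (f k)] for all [k], to which the product rule applies;
    refolding gives the [n]-th power.  The sets [A v] may overlap. *)
Lemma has_mean_prod_draws (V : finType) (a q : V -> R) (A : V -> set nat) :
  (forall v k, P (X k @^-1` A v) = (q v)%:E) ->
  has_mean P (fun w => \prod_(k < n) \sum_v a v * \1_(A v) (X k w))
    ((\sum_v a v * q v) ^+ n).
Proof.
move=> hq.
pose E (f : {ffun 'I_n -> V}) := \bigcap_k (X k @^-1` A (f k)).
have mX k v : measurable (X k @^-1` A v).
  by rewrite -[_ @^-1` _]setTI; exact: measurable_funPT.
have mE f : measurable (E f).
  by apply: fin_bigcap_measurable => // k _; apply: mX.
have PE f : P (E f) = (\prod_k q (f k))%:E.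
  rewrite iidX.1 // -prodEFin; apply: eq_bigr => k _; exact: hq.
have := has_mean_sum (enum {ffun 'I_n -> V})
   (fun f => has_meanZ (\prod_k a (f k)) (has_mean_indic (mE f) (PE f))).
apply: has_mean_eq => [w|].
  rewrite bigA_distr_bigA /= big_enum; apply: eq_bigr => f _.
  rewrite big_split /=; congr (_ * _).
  rewrite indicE; have [wE|wE] := boolP (w \in E f).
    rewrite big1// => k _; rewrite indicE mem_set//.
    by move: wE; rewrite inE; apply.
  apply/esym/eqP; rewrite prodf_seq_eq0.
  have [k wk] : exists k, ~ A (f k) (X k w).
    apply/not_existsP => h; move: wE; rewrite notin_setE; apply => k _.
    exact: contrapT (h k).
  by apply/hasP; exists k; rewrite ?mem_index_enum//= indicE memNset.
rewrite -[in RHS](card_ord n) -prodr_const bigA_distr_bigA big_enum /=.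
by apply: eq_bigr => f _; rewrite big_split.
Qed.

Lemma has_mean_prod_two (i j : nat) (a b c : R) :
  has_mean P
    (fun w => \prod_(k < n) (a + b * (X k w == i)%:R + c * (X k w == j)%:R))
    ((a + b * p i + c * p j) ^+ n).
Proof.
pose A (v : 'I_3) : set nat := nth setT [:: setT; [set i]; [set j]] v.
pose al (v : 'I_3) : R := nth 0 [:: a; b; c] v.
pose q (v : 'I_3) : R := nth 0 [:: 1; p i; p j] v.
have hq v k : P (X k @^-1` A v) = (q v)%:E.
  case: v => -[|[|[|//]]] ?; rewrite /A /q /=; last 2 first.
  - exact: iidX.2.
  - exact: iidX.2.
  by rewrite preimage_setT probability_setT.
apply: has_mean_eq (has_mean_prod_draws al hq) => [w|].
  apply: eq_bigr => k _; rewrite !big_ord_recl big_ord0 /al /A /=.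
  rewrite !indicE in_setT mulr1 addr0 addrA.
  have in1 (x y : nat) : (x \in [set y]) = (x == y) by apply/idP/eqP; rewrite inE.
  by rewrite !in1.
congr (_ ^+ _); rewrite !big_ord_recl big_ord0 /al /q /=; ring.
Qed.

End draws.

(** * Exponential estimates *)

Section exp_bounds.
Context (R : realType).
Implicit Types (s x q : R).

(** From [exp (- s / 2) >= 1 - s / 2], squared and inverted. *)
Lemma expR_le1D2x s : 0 <= s <= 2^-1 -> expR s <= 1 + 2 * s.
Proof.
move=> /andP[s0 s1].
have h := expR_ge1Dx (- (s / 2)).
have hE : expR s * expR (- (s / 2)) ^+ 2 = 1.
  by rewrite -expRM_natl -expRD -[RHS](@expR0 R); congr expR; lra.
have h2 : (1 - s / 2) ^+ 2 <= expR (- (s / 2)) ^+ 2.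
  by rewrite ler_sqr ?nnegrE; lra.
have h3 : 1 <= (1 + 2 * s) * (1 - s / 2) ^+ 2 by nra.
rewrite -(@ler_pM2r _ (expR (- (s / 2)) ^+ 2)) ?exprn_gt0 ?expR_gt0// hE.
by apply: le_trans h3 _; rewrite ler_wpM2l//; lra.
Qed.

(** This is [exp (x / 2) >= 1 + x / 2], squared. *)
Lemma expR_ge_quadratic x : -2 <= x -> 1 + x + x ^+ 2 / 4 <= expR x.
Proof.
move=> x2; have h := expR_ge1Dx (x / 2).
have -> : expR x = expR (x / 2) ^+ 2.
  by rewrite -expRM_natl; congr expR; lra.
have : (1 + x / 2) ^+ 2 <= expR (x / 2) ^+ 2 by rewrite ler_sqr ?nnegrE; lra.
by apply: le_trans; nra.
Qed.

(** A Bernoulli variable of parameter [q], centred, has moment generating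
    function at least [1 + q (1 - q) s^2 / 4]: apply [expR_ge_quadratic] at its two
    values; the linear terms cancel. *)
Lemma bernoulli_mgf_ge q s : 0 <= q <= 1 -> 0 <= s <= 1 ->
  expR (s * q + q * (1 - q) * s ^+ 2 / 8) <= 1 + (expR s - 1) * q.
Proof.
move=> /andP[q0 q1] /andP[s0 s1].
have -> : 1 + (expR s - 1) * q =
    expR (s * q) * ((1 - q) * expR (- (s * q)) + q * expR (s * (1 - q))).
  rewrite mulrDr !(mulrCA (expR (s * q))) -!expRD subrr expR0.
  by rewrite (_ : s * q + s * (1 - q) = s); ring.
rewrite expRD ler_wpM2l ?expR_ge0//.
pose y := q * (1 - q) * s ^+ 2.
have y0 : 0 <= y by rewrite /y !mulr_ge0 ?sqr_ge0//; lra.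
have y1 : y <= 1.
  rewrite /y (_ : 1 = 1 * 1)//; last ring.
  by apply: ler_pM; [nra|exact: sqr_ge0|nra|nra].
have yE : expR (y / 8) <= 1 + y / 4.
  apply: le_trans (expR_le1D2x _) _; [apply/andP; split; lra|lra].
apply: le_trans yE _.
have sq : 0 <= s * q <= 1 by nra.
have sq' : 0 <= s * (1 - q) <= 1 by nra.
have e1 : -2 <= - (s * q) by lra.
have e2 : -2 <= s * (1 - q) by lra.
have h1 := expR_ge_quadratic e1.
have h2 := expR_ge_quadratic e2.
have q1' : 0 <= 1 - q by lra.
have h1' := ler_wpM2l q1' h1.
have h2' := ler_wpM2l q0 h2.
have h3 := lerD h1' h2'.
apply: le_trans h3; rewrite le_eqVlt; apply/orP; left; apply/eqP.
by rewrite /y; field.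
Qed.

End exp_bounds.

(** * Exponentially tilted counts *)

Section tilt.
Context d (T : measurableType d) (R : realType) (P : probability T R).
Variables (p : nat -> R) (n : nat) (X : 'I_n -> {RV P >-> nat}).
Hypothesis iidX : iid_draws p X.
Hypothesis p0 : forall i, 0 <= p i.
Hypothesis p1 : forall i, p i <= 1.

(** This is [exp (s c_i)] divided by its mean, [c_i] being the count of symbol [i]
    ([tiltE]); written as a product over draws so that moments follow from
    independence. *)
Definition tilt (i : nat) (s : R) (w : T) : R :=
  \prod_(k < n)
    ((1 + (expR s - 1) * (X k w == i)%:R) / (1 + (expR s - 1) * p i)).

Let expRB1_ge0 (s : R) : 0 <= s -> 0 <= expR s - 1.
Proof.
by move=> s0; rewrite subr_ge0; apply: le_trans (expR_ge1Dx s); rewrite lerDl.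
Qed.

Let mgf_gt0 i s : 0 <= s -> 0 < 1 + (expR s - 1) * p i.
Proof.
by move=> s0; rewrite ltr_pwDl// mulr_ge0// expRB1_ge0.
Qed.

Lemma tiltE i s w : tilt i s w =
  expR (s * #|[pred k | X k w == i]|%:R) / (1 + (expR s - 1) * p i) ^+ n.
Proof.
rewrite /tilt prodf_div; congr (_ / _); last by rewrite prodr_const card_ord.
rewrite (eq_bigr (fun k => if X k w == i then expR s else 1)); last first.
  by move=> k _; case: ifP => _; rewrite ?(mulr1, mulr0); ring.
by rewrite -big_mkcond /= prodr_const -expRM_natr.
Qed.

Lemma tilt_mean i s : 0 <= s -> has_mean P (tilt i s) 1.
Proof.
move=> /(mgf_gt0 i) h.
set c := 1 + _ in h; pose a := expR s - 1.
apply: has_mean_eq (has_mean_prod_two iidX i i c^-1 (a / c) 0) => [w|].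
  by apply: eq_bigr => k _; rewrite -/c -/a; ring.
rewrite (_ : _ + _ = 1) ?expr1n//.
by rewrite mul0r addr0 /c -/a; field; rewrite gt_eqF.
Qed.

(** With [a = expR s - 1 <= 2 s] and [c = 1 + a p_i], one draw contributes
    [1 + a^2 p_i (1 - p_i) / c^2 <= exp (4 s^2 p_i (1 - p_i))]. *)
Lemma tilt_mean_sq i s : 0 <= s <= 2^-1 -> exists2 r,
  has_mean P (fun w => tilt i s w * tilt i s w) r &
  r <= expR (4 * (n%:R * (p i * (1 - p i)) * s ^+ 2)).
Proof.
move=> s01; have s0 : 0 <= s by case/andP: s01.
have h := mgf_gt0 i s0.
set c := 1 + _ in h; pose a := expR s - 1.
have meanq := has_mean_prod_two iidX i i (c ^- 2) ((2 * a + a ^+ 2) / c ^+ 2) 0.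
eexists.
  apply: has_mean_eq meanq => [w|]; last by [].
  rewrite /tilt -big_split; apply: eq_bigr => k _; rewrite -/c -/a /=.
  by case: (X k w == i) => /=; field; rewrite gt_eqF.
have a0 : 0 <= a by exact: expRB1_ge0.
have a2 : a <= 2 * s by rewrite lerBlDl; exact: expR_le1D2x.
have v0 : 0 <= p i * (1 - p i) by rewrite mulr_ge0// subr_ge0.
have -> : c ^- 2 + (2 * a + a ^+ 2) / c ^+ 2 * p i + 0 * p i =
    1 + a ^+ 2 * (p i * (1 - p i)) / c ^+ 2.
  by rewrite /c -/a; field; rewrite gt_eqF.
have c1 : 1 <= c ^+ 2.
  by rewrite exprn_ege1// /c lerDl mulr_ge0.
have -> : 4 * (n%:R * (p i * (1 - p i)) * s ^+ 2) =
  (4 * s ^+ 2 * (p i * (1 - p i))) * n%:R by ring.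
rewrite expRM_natr lerXn2r ?nnegrE ?expR_ge0//.
  by rewrite addr_ge0// divr_ge0 ?sqr_ge0// mulr_ge0 ?sqr_ge0.
apply: le_trans (expR_ge1Dx _); rewrite lerD2l.
apply: (@le_trans _ _ (a ^+ 2 * (p i * (1 - p i)))).
  rewrite ler_pdivrMr; last by apply: lt_le_trans c1.
  by rewrite ler_peMr// mulr_ge0// sqr_ge0.
by rewrite ler_wpM2r//; nra.
Qed.

(** Negative dependence of counts: a draw cannot equal both [i] and [j], so it
    contributes [(1 + a p_i + b p_j) / ((1 + a p_i) (1 + b p_j)) <= 1]. *)
Lemma tilt_mean_cross i j s t : i != j -> 0 <= s -> 0 <= t -> exists2 r,
  has_mean P (fun w => tilt i s w * tilt j t w) r & r <= 1.
Proof.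
move=> ij s0 t0.
have h := mgf_gt0 i s0; have h' := mgf_gt0 j t0.
set c := 1 + _ in h; pose a := expR s - 1.
set c' := 1 + _ in h'; pose b := expR t - 1.
have a0 : 0 <= a by exact: expRB1_ge0.
have b0 : 0 <= b by exact: expRB1_ge0.
have cc : 0 < c * c' by rewrite mulr_gt0.
have meanq := has_mean_prod_two iidX i j (c * c')^-1 (a / (c * c')) (b / (c * c')).
eexists.
  apply: has_mean_eq meanq => [w|]; last by [].
  rewrite /tilt -big_split; apply: eq_bigr => k _; rewrite -/c -/c' -/a -/b /=.
  have [Xi|_] := eqVneq (X k w) i; have [Xj|_] := eqVneq (X k w) j.
  - by move: ij; rewrite -Xi -Xj eqxx.
  - by rewrite /=; field; rewrite !gt_eqF.
  - by rewrite /=; field; rewrite !gt_eqF.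
  - by rewrite /=; field; rewrite !gt_eqF.
have -> : (c * c')^-1 + a / (c * c') * p i + b / (c * c') * p j =
  (1 + a * p i + b * p j) / (c * c') by field; rewrite !gt_eqF.
have pa : 0 <= a * p i by rewrite mulr_ge0.
have pb : 0 <= b * p j by rewrite mulr_ge0.
apply: exprn_ile1; first by rewrite divr_ge0 ?(ltW cc)// !addr_ge0.
rewrite ler_pdivrMr// mul1r.
have -> : c * c' = 1 + a * p i + b * p j + a * p i * (b * p j).
  by rewrite /c /c' -/a -/b; ring.
by rewrite lerDl mulr_ge0.
Qed.

(** The normalisation of [tilt] is at least
    [exp (n s p_i + n p_i (1 - p_i) s^2 / 8)], so a weight of at least
    [1/2 >= 1/e] forces [s c_i] to be at least this exponent minus 1. *)
Lemma tilt_large i s w : 0 <= s <= 1 -> 2^-1 <= tilt i s w ->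
  n%:R * (p i * (1 - p i)) * s ^+ 2 / 8 - 1 <=
    s * (#|[pred k | X k w == i]|%:R - n%:R * p i).
Proof.
move=> s01; have s0 : 0 <= s by case/andP: s01.
have h := mgf_gt0 i s0; rewrite tiltE.
rewrite ler_pdivlMr ?exprn_gt0// => H.
have q01 : 0 <= p i <= 1 by rewrite p0 p1.
set N := #|_| in H *.
have half : expR (-1) <= 2^-1 :> R.
  rewrite expRN lef_pV2 ?posrE ?expR_gt0//.
  by apply: le_trans (expR_ge1Dx 1); lra.
suff : expR ((s * p i + p i * (1 - p i) * s ^+ 2 / 8) * n%:R - 1) <=
    expR (s * N%:R).
  by rewrite ler_expR; lra.
apply: le_trans H; rewrite addrC expRD.
apply: ler_pM; rewrite ?expR_ge0// expRM_natr.
rewrite lerXn2r ?nnegrE ?expR_ge0 ?(ltW h)//.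
exact: bernoulli_mgf_ge.
Qed.

End tilt.

(** * The sup distance for a fixed sample size *)

Section sup_dist.
Context (R : realType).
Implicit Types (p q : nat -> R).

Lemma mle_itv n (x : 'I_n -> nat) i : 0 <= mle R x i <= 1.
Proof.
rewrite /mle divr_ge0 ?ler0n//=.
have [->|n0] := eqVneq (n%:R : R) 0; first by rewrite invr0 mulr0.
by rewrite ler_pdivrMr ?lt_def ?n0 ?ler0n// mul1r ler_nat -[leqRHS]card_ord max_card.
Qed.

Lemma sup_dist_ge p q i : (forall j, 0 <= p j <= 1) -> (forall j, 0 <= q j <= 1) ->
  `|p i - q i| <= sup_dist p q.
Proof.
move=> p01 q01; apply: ub_le_sup; last by exists i.
exists 1 => _ [j _ <-]; rewrite ler_norml.
by have /andP[? ?] := p01 j; have /andP[? ?] := q01 j; apply/andP; split; lra.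
Qed.

Lemma sup_dist_ge0 p q : (forall j, 0 <= p j <= 1) -> (forall j, 0 <= q j <= 1) ->
  0 <= sup_dist p q.
Proof. by move=> p01 q01; apply: le_trans (sup_dist_ge 0 p01 q01). Qed.

Lemma distribution_le1 p i : is_distribution p -> 0 <= p i <= 1.
Proof.
move=> hp; rewrite hp.1 /=.
by have := uniq_sum_le1 hp (l := [:: i]) isT; rewrite big_seq1.
Qed.

End sup_dist.

Section finite_sample.
Context d (T : measurableType d) (R : realType) (P : probability T R).
Variables (p : nat -> R) (n : nat) (X : 'I_n -> {RV P >-> nat}).
Hypothesis hp : is_distribution p.
Hypothesis iidX : iid_draws p X.
Variables (m : nat) (f : 'I_m.+1 -> nat) (v lam C : R).
Hypothesis f_inj : injective f.
Hypothesis v_gt0 : 0 < v.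
Hypothesis v_le : forall j, v <= p (f j) * (1 - p (f j)).
Hypothesis lam_gt0 : 0 < lam.
Hypothesis lam_ge : 16 <= lam ^+ 2.
Hypothesis n_large : 4 * lam ^+ 2 <= n%:R * v.
Hypothesis C_large : expR (4 * lam ^+ 2) <= C * m.+1%:R.

Let var j := p (f j) * (1 - p (f j)).
(* Chosen so that the exponent [n * var j * s j ^+ 2] is [lam ^+ 2] for every [j]. *)
Let s j := lam / Num.sqrt (n%:R * var j).

Let n_gt0 : 0 < n%:R :> R.
Proof.
rewrite -(pmulr_lgt0 _ v_gt0); apply: lt_le_trans n_large.
by rewrite mulr_gt0// exprn_gt0.
Qed.

Let nvar_gt0 j : 0 < n%:R * var j.
Proof. by rewrite mulr_gt0//; apply: lt_le_trans (v_le j). Qed.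

Let s_gt0 j : 0 < s j.
Proof. by rewrite divr_gt0// sqrtr_gt0. Qed.

Let s_sqr j : n%:R * var j * s j ^+ 2 = lam ^+ 2.
Proof.
rewrite /s expr_div_n sqr_sqrtr ?ltW// mulrC divfK//.
by rewrite gt_eqF.
Qed.

Let s_le j : s j <= 2^-1.
Proof.
rewrite ler_pdivrMr ?sqrtr_gt0//.
have h : (2 * lam) ^+ 2 <= n%:R * var j.
  apply: le_trans (_ : n%:R * v <= _); last by rewrite ler_wpM2l ?(ltW n_gt0)// v_le.
  by apply: le_trans n_large; lra.
have : 2 * lam <= Num.sqrt (n%:R * var j).
  have lam2 : 0 <= 2 * lam by rewrite mulr_ge0 ?ltW.
  by rewrite -[leLHS](ger0_norm lam2) -sqrtr_sqr ler_wsqrtr.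
lra.
Qed.

Let p01 i : 0 <= p i <= 1.
Proof. exact: distribution_le1. Qed.

Let p_ge0 i : 0 <= p i. Proof. by case/andP: (p01 i). Qed.
Let p_le1 i : p i <= 1. Proof. by case/andP: (p01 i). Qed.

Let S w := m.+1%:R^-1 * \sum_j tilt p X (f j) (s j) w.

Let S_mean : has_mean P S 1.
Proof.
have := has_meanZ m.+1%:R^-1 (has_mean_sum (enum 'I_m.+1)
  (fun j => tilt_mean iidX p_ge0 (f j) (ltW (s_gt0 j)))).
apply: has_mean_eq => [w|]; first by rewrite big_enum.
by rewrite big_enum/= sumr_const card_ord mulVf// pnatr_eq0.
Qed.

Let S_mean_sq : exists2 b, has_mean P (fun w => S w ^+ 2) b & b <= 1 + C.
Proof.
pose K := expR (4 * lam ^+ 2).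
have pair (jk : 'I_m.+1 * 'I_m.+1) : exists r,
    has_mean P (fun w =>
      tilt p X (f jk.1) (s jk.1) w * tilt p X (f jk.2) (s jk.2) w) r /\
    r <= 1 + (if jk.1 == jk.2 then K else 0).
  case: jk => j k /=; have [<-|jk] := eqVneq j k.
    have sj : 0 <= s j <= 2^-1 by rewrite ltW//= s_le.
    have [r hr rle] := tilt_mean_sq iidX p_ge0 p_le1 (f j) sj.
    exists r; split=> //; apply: le_trans rle _.
    by rewrite -/(var j) s_sqr lerDr.
  have fjk : f j != f k by rewrite (inj_eq f_inj).
  have [r hr rle] := tilt_mean_cross iidX p_ge0 fjk (ltW (s_gt0 j)) (ltW (s_gt0 k)).
  by exists r; split=> //; rewrite addr0.
have [r hr] := choice pair.
have S2 := has_meanZ (m.+1%:R ^- 2) (has_mean_sum (enum 'I_m.+1) (fun j =>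
  has_mean_sum (enum 'I_m.+1) (fun k => (hr (j, k)).1))).
exists (m.+1%:R ^- 2 * \sum_j \sum_k r (j, k)).
  apply: has_mean_eq S2 => [w|].
    rewrite big_enum /S exprMn exprVn; congr (_ * _).
    rewrite expr2 mulr_suml; apply: eq_bigr => j _.
    by rewrite big_enum mulr_sumr.
  by rewrite big_enum; congr (_ * _); apply: eq_bigr => j _; rewrite big_enum.
have M0 : 0 < m.+1%:R :> R by rewrite ltr0n.
rewrite mulrC ler_pdivrMr ?exprn_gt0//.
apply: (@le_trans _ _ (\sum_(j < m.+1) (m.+1%:R + K))).
  apply: ler_sum => j _.
  apply: (@le_trans _ _ (\sum_(k < m.+1) (1 + (if j == k then K else 0)))).
    by apply: ler_sum => k _; exact: (hr (j, k)).2.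
  rewrite big_split /= sumr_const card_ord -big_mkcond /=.
  by rewrite (big_pred1 j)// => k; rewrite eq_sym.
rewrite sumr_const card_ord -[leLHS]mulr_natr.
have := ler_wpM2r (ltW M0) C_large; rewrite -/K; nra.
Qed.

(** Applied with [C] an absolute constant: [C_large] allows [lam ^+ 2] to grow like
    a quarter of [ln m.+1], and [n_large] makes every tilting parameter at most
    [1/2], where all the exponential estimates hold. *)
Lemma expected_sup_dist_ge :
  ((lam * Num.sqrt v / 16 / (4 * (1 + C)))%:E <=
    (Num.sqrt n%:R)%:E * 'E_P[fun w => sup_dist p (mle R (fun k => X k w))])%E.
Proof.
have C0 : 0 < C.
  rewrite -(pmulr_lgt0 _ (_ : 0 < m.+1%:R)) ?ltr0n//.
  by apply: lt_le_trans C_large; rewrite expR_gt0.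
have [b S2 bC] := S_mean_sq.
have B0 : 0 < 1 + C by lra.
have [mA PA] := paley_zygmund_half S_mean S2 bC B0.
have q01 w := mle_itv R (fun k => X k w).
have n0 : 0 < Num.sqrt n%:R :> R by rewrite sqrtr_gt0.
pose t := lam * Num.sqrt v / 16 / Num.sqrt n%:R.
have t0 : 0 <= t by rewrite ltW// /t !divr_gt0// mulr_gt0// sqrtr_gt0.
have tE : lam * Num.sqrt v / 16 / (4 * (1 + C)) =
    Num.sqrt n%:R * (t * (4 * (1 + C))^-1).
  by rewrite /t; field; rewrite !gt_eqF//; lra.
rewrite unlock tE EFinM; apply: lee_wpmul2l; first by rewrite lee_fin ltW.
apply: (@le_trans _ _ (t%:E * P [set w | (2^-1 <= S w)%R])%E).
  by rewrite EFinM; apply: lee_wpmul2l; rewrite ?lee_fin.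
apply: markov_nonmeasurable => // [w|w /= Sw]; first exact: sup_dist_ge0.
(* The average is at least 1/2, hence so is one of the weights. *)
have [j Wj] : exists j, 2^-1 <= tilt p X (f j) (s j) w.
  apply/not_existsP => h; move: Sw; apply/negP; rewrite -ltNge /S mulrC.
  rewrite ltr_pdivrMr ?ltr0n//.
  apply: (@lt_le_trans _ _ (\sum_(j < m.+1) 2^-1)); last first.
    by rewrite sumr_const card_ord mulr_natr.
  apply: ltr_sum; first by apply/hasP; exists ord0; rewrite ?mem_index_enum.
  by move=> j _; rewrite ltNge; apply/negP/h.
have s01 : 0 <= s j <= 1.
  by rewrite ltW//=; apply: le_trans (s_le j) _; lra.
have := tilt_large p_ge0 p_le1 s01 Wj.
rewrite -/(var j) s_sqr; set N := #|_| => hN.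
apply: le_trans (sup_dist_ge (f j) p01 (q01 w)).
rewrite distrC; apply: le_trans (ler_norm _).
rewrite /mle -/N.
have nE : n%:R = Num.sqrt n%:R ^+ 2 :> R by rewrite sqr_sqrtr ?ltW.
have snv : Num.sqrt (n%:R * var j) = Num.sqrt n%:R * Num.sqrt (var j).
  by rewrite sqrtrM ?ltW.
have vv : Num.sqrt v <= Num.sqrt (var j) by rewrite ler_wsqrtr// v_le.
(* [tilt_large] gives [lam ^+ 2 / 8 - 1], which is at least [lam ^+ 2 / 16] by
   [lam_ge]. *)
have dev : lam / 16 * Num.sqrt (n%:R * var j) <= N%:R - n%:R * p (f j).
  rewrite -(ler_pM2l (s_gt0 j)); apply: le_trans hN.
  rewrite (_ : s j * _ = lam ^+ 2 / 16).
    by move: (lam ^+ 2) lam_ge => y; lra.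
  by rewrite /s; field; rewrite gt_eqF// sqrtr_gt0.
rewrite (_ : _ - _ = (N%:R - n%:R * p (f j)) / n%:R); last by field; rewrite gt_eqF.
rewrite ler_pdivlMr//; apply: le_trans dev.
have -> : t * n%:R = lam / 16 * (Num.sqrt n%:R * Num.sqrt v).
  by rewrite [X in _ * X = _]nE /t; field; rewrite gt_eqF.
rewrite snv.
by rewrite ler_wpM2l ?ler_wpM2l// ?ltW// divr_gt0.
Qed.

End finite_sample.

(** * Passage to the limit *)

Lemma limn_einf_ge (R : realType) (u : (\bar R)^nat) (a : \bar R) N :
  (forall n, (N <= n)%N -> (a <= u n)%E) -> (a <= limn_einf u)%E.
Proof.
move=> h; rewrite limn_einf_lim; apply: lime_ge; first exact: is_cvg_einfs.
exists N => // k /= Nk; apply: le_ereal_inf_tmp => _ [n /= kn <-].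
exact/h/(leq_trans Nk).
Qed.

(** The difference of the two sides is [(p j - p i) (1 - p i - p j)]. *)
Lemma heavier_variance (R : realType) (p : nat -> R) i j :
  is_distribution p -> i != j -> p i <= p j ->
  p i * (1 - p i) <= p j * (1 - p j).
Proof.
move=> hp ij le_ij.
have := uniq_sum_le1 hp (l := [:: i; j]).
by rewrite /= mem_seq1 ij big_cons big_seq1 => /(_ isT); nra.
Qed.

Theorem proposition6 (R : realType) :
  exists2 c : R, 0 < c &
    forall p : nat -> R, is_distribution p ->
    forall (d : nat -> measure_display)
      (Omega : forall n, measurableType (d n))
      (P : forall n, probability (Omega n) R)
      (X : forall n, 'I_n -> {RV (P n) >-> nat}),
    (forall n, iid_draws p (X n)) ->
    ((c * Num.sqrt (Vstar p))%:E <=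
      limn_einf (fun n => (Num.sqrt n%:R)%:E *
        'E_(P n)[fun w => sup_dist p (mle R (fun k => X n k w))]))%E.
Proof.
pose K : R := expR 64; have K0 : 0 < K by rewrite expR_gt0.
(* 128 is [16 * 4 * 2]: 16 from the deviation, 4 from [paley_zygmund_half], and 2
   from [lam >= sqrt (ln i.+2%:R) / 2]. *)
pose c := (128 * (1 + 2 * K))^-1.
have c0 : 0 < c by rewrite invr_gt0; lra.
exists c => // p hp d Omega P X iidX; set L := limn_einf _.
have p01 i := distribution_le1 i hp.
have L0 : (0 <= L)%E.
  apply: (@limn_einf_ge _ _ _ 0) => n _; rewrite mule_ge0 ?lee_fin//.
  by apply: expectation_ge0 => w; apply: sup_dist_ge0 => // j; exact: mle_itv.
have [s hs] := sorts_exists hp; have [s_inj _ s_mono] := hs.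
pose V i := decr p i * (1 - decr p i) * ln i.+2%:R.
have VL i : ((c * Num.sqrt (V i))%:E <= L)%E.
  pose v := p (s i) * (1 - p (s i)).
  have VE : V i = v * ln i.+2%:R by rewrite /V (decrE hp hs).
  have ln0 : 0 < ln i.+2%:R :> R by rewrite ln_gt0// ltr1n.
  have [v0|v0] := leP v 0.
    by rewrite ler0_sqrtr ?mulr0// VE pmulr_lle0.
  (* The 16 is what [expected_sup_dist_ge] requires; the factor 1/4 makes
     [expR (4 * lam2)] equal to [K * i.+2%:R], at most [2 * K] times the number
     [i.+1] of symbols used. *)
  pose lam2 := 16 + ln i.+2%:R / 4 : R.
  have lam20 : 0 < lam2 by rewrite /lam2; lra.
  pose lam := Num.sqrt lam2.
  have lamE : lam ^+ 2 = lam2 by rewrite sqr_sqrtr// ltW.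
  apply: (@limn_einf_ge _ _ _ (Num.truncn (4 * lam2 / v)).+1) => n Nn.
  apply: le_trans (@expected_sup_dist_ge _ _ _ _ p n (X n) hp (iidX n) i
    (fun j => s j) v lam (2 * K) _ _ _ _ _ _ _).
  - rewrite lee_fin VE (sqrtrM _ (ltW v0)).
    rewrite (_ : _ / (4 * _) = c * (Num.sqrt v * (2 * lam))); last first.
      by rewrite /c; field; lra.
    rewrite ler_wpM2l ?(ltW c0)// ler_wpM2l//.
    have -> : 2 * lam = Num.sqrt (4 * lam2).
      rewrite sqrtrM// (_ : 4 = 2 ^+ 2)//; last ring.
      by rewrite sqrtr_sqr ger0_norm.
    by rewrite ler_wsqrtr// /lam2; lra.
  - by move=> j k /s_inj/val_inj.
  - by [].
  - move=> j; have [->//|ij] := eqVneq (s j) (s i).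
    apply: (heavier_variance hp); first by rewrite eq_sym.
    by apply: s_mono; rewrite -ltnS ltn_ord.
  - by rewrite sqrtr_gt0.
  - by rewrite lamE /lam2; lra.
  - rewrite lamE -ler_pdivrMr//; apply: ltW.
    apply: lt_le_trans (_ : (Num.truncn (4 * lam2 / v)).+1%:R <= _).
      by apply: truncnS_gt.
    by rewrite ler_nat.
  - rewrite lamE (_ : 4 * lam2 = 64 + ln i.+2%:R); last by rewrite /lam2; lra.
    rewrite expRD lnK ?posrE ?ltr0n// -/K (mulrC 2) -mulrA ler_wpM2l ?(ltW K0)//.
    by rewrite -natrM ler_nat mul2n -addnn addSnnS leq_addl.
case: L L0 VL => [l|_ _|//]; last by rewrite leey.
rewrite lee_fin => l0 VL; rewrite lee_fin -ler_pdivlMl//.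
have ub : Vstar p <= (c^-1 * l) ^+ 2.
  apply: ge_sup; first by exists (V 0%N), 0%N.
  move=> _ [i _ <-]; rewrite -/(V i).
  have := VL i; rewrite lee_fin -ler_pdivlMl// => h.
  have [Vi|Vi] := leP 0 (V i); last by apply: le_trans (ltW Vi) (sqr_ge0 _).
  by rewrite -(sqr_sqrtr Vi) ler_sqr ?nnegrE// mulr_ge0// invr_ge0 ltW.
apply: le_trans (ler_wsqrtr ub) _.
by rewrite sqrtr_sqr ger0_norm// mulr_ge0// invr_ge0 ltW.
Qed.
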